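(* Let $\frac{s(n)}{S},\frac{t(n)}{T}\in\mathrm{IQ}$. Then there are $\frac{a(n)}{d_1},\frac{b(n)}{d_2}\in\mathrm{IQ}$ such that for all sufficiently large $n$, $$\gcd\left(\frac{s(n)}{S},\frac{t(n)}{T}\right)=\frac{a(n)}{d_1}\cdot\frac{s(n)}{S}+\frac{b(n)}{d_2}\cdot\frac{t(n)}{T}.$$
   Context: An (integral) quasipolynomial is a function $p:\mathbb{N}\to\mathbb{Z}$ for which there are a positive integer $\pi$ and polynomials $p_0,\dots,p_{\pi-1}\in\mathbb{Z}[n]$ with $p(n)=p_{n \bmod \pi}(n)$ for all $n\in\mathbb{N}$ (where $\mathbb{N}$ includes $0$). A function $q:\mathbb{N}\to\mathbb{Z}$ is in the class $\mathrm{IQ}$ if $q(n)=p(n)/C$, where $p$ is an integral quasipolynomial and $C$ is a nonzero integer constant such that $C$ divides $p(n)$ for all $n\ge 0$. Writing $p(n)/C\in\mathrm{IQ}$ means that $p$ and $C$ are of this form. The gcd of two integers is the nonnegative one, with $\gcd(0,0)=0$. *)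

(* Defs.v *)
From mathcomp Require Import all_boot all_order all_algebra.

Set Implicit Arguments.
Unset Strict Implicit.
Unset Printing Implicit Defensive.

Import Order.TTheory GRing.Theory Num.Theory.
Local Open Scope ring_scope.

(* Only the constituents [ps 0, ..., ps m.-1] matter. *)
Definition quasipolynomial (p : nat -> int) : Prop :=
  exists (m : nat) (ps : nat -> {poly int}),
    (0 < m)%N /\ forall n : nat, p n = (ps (n %% m)%N).[n%:Z].

(* The assertion "p(n)/C is in IQ", in the sense that p and C are the
   numerator and the denominator of such a presentation.  The function itself
   is [fun n => (p n %/ C)%Z], an exact quotient by the last conjunct. *)
Definition inIQ (p : nat -> int) (C : int) : Prop :=
  [/\ quasipolynomial p, C != 0 & forall n : nat, (C %| p n)%Z].

(* Main.v *)
Require Import Defs.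
From mathcomp Require Import all_boot all_order all_algebra.
From mathcomp Require Import ring zify.

Import Order.TTheory GRing.Theory Num.Theory.
Local Open Scope ring_scope.

(* On a residue class modulo the periods, s/S and t/T are polynomials.
   Clearing denominators and dividing by their gcd h in Q[x], one gets
   k s/S = h F and k t/T = h G with an identity A F + B G = D, where
   D <> 0 is an integer.  On a class modulo D, e = gcd(F(n), G(n)) is constant:
   it divides D, and F(n), G(n) are constant modulo D.  Write
   e = x F(i) + y G(i) at one point i of the class; then
   x F(n) + y G(n) - e = D w(n) with w(n) an integer, and
   e = (x - w(n) A(n)) F(n) + (y - w(n) B(n)) G(n).  Multiplying by |h(n)|,
   which is +h(n) or -h(n) for all large n, gives the claim on the class. *)

(* Integrality is required on all of K, not only past N, so that solutions on
   residue classes glue to elements of IQ. *)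
Definition IQ_solvable (K : pred nat) (R : nat -> int -> int -> Prop) : Prop :=
  exists (C : int) (m N : nat) (a b : nat -> {poly int}),
    [/\ C != 0, (0 < m)%N &
      forall n, K n ->
        [/\ (C %| (a (n %% m)%N).[n%:Z])%Z, (C %| (b (n %% m)%N).[n%:Z])%Z &
          (N <= n)%N -> R n ((a (n %% m)%N).[n%:Z] %/ C)%Z
                            ((b (n %% m)%N).[n%:Z] %/ C)%Z]].

(** The product of all [C i] serves as common denominator, so the numerators on class [i] are scaled
    by the product [C' i] of the others. The residue of [n] modulo [m * \prod_i l i] determines both
    its class and its residue modulo the period of that class. *)
Lemma IQ_solvable_glue (K : pred nat) (R : nat -> int -> int -> Prop) (m : nat) :
  (0 < m)%N ->
  (forall i, (i < m)%N ->
    IQ_solvable (fun n => K n && (n %% m == i)%N) R) ->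
  IQ_solvable K R.
Proof.
move=> m_gt0 solR.
have /fin_all_exists[C /fin_all_exists[l /fin_all_exists[N
    /fin_all_exists[a /fin_all_exists[b solP]]]]] (i : 'I_m) := solR i (ltn_ord i).
pose cls r := Ordinal (ltn_pmod r m_gt0).
pose C' i := \prod_(j | j != i) C j.
pose lift (p : 'I_m -> nat -> {poly int}) r :=
  C' (cls r) *: p (cls r) (r %% l (cls r))%N.
have C'_neq0 i : C' i != 0.
  by apply/prodf_neq0 => j _; have [] := solP j.
have CE i : \prod_j C j = C' i * C i by rewrite mulrC (bigD1 i).
have liftE p n : (lift p (n %% (m * \prod_i l i))%N).[n%:Z] =
    C' (cls n) * (p (cls n) (n %% l (cls n))%N).[n%:Z].
  have cls_mod : cls (n %% (m * \prod_i l i))%N = cls n.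
    by apply: val_inj; rewrite /= modn_dvdm // dvdn_mulr.
  by rewrite /lift cls_mod hornerZ modn_dvdm // dvdn_mull // (bigD1 (cls n)) // dvdn_mulr.
exists (\prod_i C i), (m * \prod_i l i)%N, (\max_i N i), (lift a), (lift b).
split.
- by apply/prodf_neq0 => j _; have [] := solP j.
- by rewrite muln_gt0 m_gt0 prodn_gt0 // => j; have [] := solP j.
move=> n Kn; have [_ _ /(_ n)] := solP (cls n).
rewrite Kn eqxx => /(_ isT)[Ca Cb Rab].
rewrite !liftE (CE (cls n)) !dvdz_mul //; split=> // N_le_n.
rewrite !divzMl //; apply: Rab; apply: leq_trans N_le_n.
exact: (leq_bigmax (cls n)).
Qed.

Lemma horner_int_eventually_sgn (h : {poly int}) :
  h != 0 -> exists (e : int) (N : nat),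
    `|e| = 1 /\ forall n : nat, (N <= n)%N -> 0 < e * h.[n%:Z].
Proof.
elim/poly_ind: h => [|p c IH]; first by rewrite eqxx.
have [-> |/IH[e [N [e1 pN]]] _] := eqVneq p 0.
  rewrite mul0r add0r polyC_eq0 => c_neq0; exists (Num.sg c), 0%N.
  by rewrite normr_sg c_neq0; split=> // n _; rewrite hornerC -normrEsg normr_gt0.
(* By integrality [e * p(n)] is at least 1, so [n * p(n)] outweighs [c] once [n] exceeds [|c|]. *)
exists e, (N + `|c|.+1)%N; split=> // n N_le_n.
have {}pN := pN n ltac:(lia).
rewrite hornerMXaddC mulrDr mulrA.
have : `|e * c| = `|c| by rewrite normrM e1 mul1r.
nia.
Qed.

(** As [e] does not depend on [n], the absolute value can enter polynomial cofactors as a scalar. *)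
Lemma horner_int_eventually_norm (h : {poly int}) :
  exists (e : int) (N : nat),
    forall n : nat, (N <= n)%N -> `|h.[n%:Z]| = e * h.[n%:Z].
Proof.
have [->|/horner_int_eventually_sgn[e [N [e1 hN]]]] := eqVneq h 0.
  by exists 0, 0%N => n _; rewrite !horner0 normr0 mulr0.
exists e, N => n /hN h_gt0.
by rewrite -(gtr0_norm h_gt0) normrM e1 mul1r.
Qed.

Lemma dvdz_horner_sub (p : {poly int}) (d x y : int) :
  (d %| x - y)%Z -> (d %| p.[x] - p.[y])%Z.
Proof.
move=> d_xy; have /factor_theorem[q qE] : root (p - p.[y]%:P) y.
  by rewrite rootE !hornerE subrr.
have -> : p.[x] - p.[y] = q.[x] * (x - y).
  by have := congr1 (horner^~ x) qE; rewrite !hornerE.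
exact: dvdz_mull.
Qed.

Lemma poly_int_coprime_cofactors (P Q : {poly int}) :
  exists (h F G A B : {poly int}) (c D : int),
    [/\ c != 0, D != 0, c *: P = h * F, c *: Q = h * G &
        A * F + B * G = D%:P].
Proof.
have [gcd0|gcd_neq0] := eqVneq (gcdp P Q) 0.
  move/eqP: gcd0; rewrite gcdp_eq0 => /andP[/eqP-> /eqP->].
  (* When [P = Q = 0], the choice [h = 0], [F = 1], [G = 0] keeps a Bezout identity available. *)
  exists 0, 1, 0, 1, 0, 1, 1.
  by split; rewrite ?scaler0 ?mul0r // mulr1 addr0.
have /Pdiv.Idomain.dvdpP[[c1 F] /= c1_neq0 FE] := dvdp_gcdl P Q.
have /Pdiv.Idomain.dvdpP[[c2 G] /= c2_neq0 GE] := dvdp_gcdr P Q.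
have [[u v] /= /eqpP[[c3 c4] /= /andP[c3_neq0 c4_neq0] uvE]] := Bezoutp P Q.
(* With [h] the gcd, [c1 P = F h], [c2 Q = G h] and [c3 (u P + v Q) = c4 h]. Multiplying the last by
   [c1 c2] and cancelling [h] leaves the constant [c1 c2 c4]. *)
exists (gcdp P Q), (c2 *: F), (c1 *: G), (c3 *: u), (c3 *: v), (c1 * c2).
exists (c1 * c2 * c4); split.
- by rewrite mulf_neq0.
- by rewrite !mulf_neq0.
- by rewrite mulrC -scalerA FE mulrC scalerAr.
- by rewrite -scalerA GE mulrC scalerAr.
apply: (mulIf gcd_neq0); rewrite mul_polyC -!scalerA -uvE.
rewrite !scalerDr mulrDl -!mul_polyC.
rewrite -!mulrA -FE -GE -!mul_polyC; ring.
Qed.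

(** Multiplied by [|k|], the left side becomes [gcd(h F, h G) = |h| e = s h (u F + v G) = s k (u f +
    v g)]; then [k = |k| sg(k)]. *)
Lemma gcdz_scaled_Bezout (f g F G h k u v e s : int) :
  k != 0 -> k * f = h * F -> k * g = h * G ->
  gcdz F G = e -> u * F + v * G = e -> `|h| = s * h ->
  gcdz f g = (Num.sg k * s * u) * f + (Num.sg k * s * v) * g.
Proof.
move=> k_neq0 fE gE FG uv hs; have nk_neq0 : `|k| != 0 by rewrite normr_eq0.
apply: (mulfI nk_neq0).
rewrite -abszE mulz_gcdr fE gE -mulz_gcdr FG !abszE hs -uv.
have sgk : `|k| * Num.sg k = k by rewrite mulrC -numEsg.
transitivity (s * (u * (h * F) + v * (h * G))); first by ring.
rewrite -fE -gE -[in LHS]sgk; ring.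
Qed.

Lemma gcdz_IQ_solvable_poly (K : pred nat) (f g : nat -> int)
    (P Q : {poly int}) (M : int) :
  M != 0 ->
  (forall n, K n -> M * f n = P.[n%:Z] /\ M * g n = Q.[n%:Z]) ->
  IQ_solvable K (fun n u v => gcdz (f n) (g n) = u * f n + v * g n).
Proof.
move=> M_neq0 fgE.
have [h [F [G [A [B [c [D [c_neq0 D_neq0 PE QE ABE]]]]]]]] :=
  poly_int_coprime_cofactors P Q.
have [s [N hN]] := horner_int_eventually_norm h.
apply: (@IQ_solvable_glue _ _ `|D|%N); first by rewrite absz_gt0.
move=> i _.
have ABDE n : A.[n] * F.[n] + B.[n] * G.[n] = D.
  by have := congr1 (horner^~ n) ABE; rewrite !hornerE.
have [x [y xyE]] := Bezoutz F.[i%:Z] G.[i%:Z].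
set e := gcdz _ _ in xyE.
have eF : (e %| F.[i%:Z])%Z by exact: dvdz_gcdl.
have eG : (e %| G.[i%:Z])%Z by exact: dvdz_gcdr.
have eD : (e %| D)%Z by rewrite -(ABDE i%:Z) rpredD ?dvdz_mull.
pose w := x *: F + y *: G - e%:P.
(* The multiplier taking [f] to [h F] and [g] to [h G] is [c * M]. *)
pose z := Num.sg (c * M) * s.
(* The cofactors are [z (x - (w/D) A)] and [z (y - (w/D) B)]. Since [w/D] is integral only at points
   of the class, [D] stays as denominator. *)
exists D, 1%N, N, (fun=> z *: (D *: x%:P - w * A)), (fun=> z *: (D *: y%:P - w * B)).
split=> // n /andP[Kn ni]; cbv beta.
have [fE gE] := fgE n Kn.
have Dni : (D %| n%:Z - i%:Z)%Z.
  by rewrite -(eqP ni) -modz_nat abszE modz_abs -eqz_mod_dvd modz_mod.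
have DF := dvdz_horner_sub F _ _ _ Dni; have DG := dvdz_horner_sub G _ _ _ Dni.
have wnE : w.[n%:Z] = x * F.[n%:Z] + y * G.[n%:Z] - e by rewrite /w !hornerE.
have /dvdzP[w0 wE] : (D %| w.[n%:Z])%Z.
  rewrite wnE -xyE.
  have -> : x * F.[n%:Z] + y * G.[n%:Z] - (x * F.[i%:Z] + y * G.[i%:Z]) =
      x * (F.[n%:Z] - F.[i%:Z]) + y * (G.[n%:Z] - G.[i%:Z]) by ring.
  by rewrite rpredD ?dvdz_mull.
have aE t H : (z *: (D *: t%:P - w * H)).[n%:Z] = z * (t - w0 * H.[n%:Z]) * D.
  rewrite hornerZ hornerD hornerN hornerM wE hornerZ hornerC; ring.
rewrite !aE !mulzK // !dvdz_mull //; split=> // N_le_n.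
have Bez : (x - w0 * A.[n%:Z]) * F.[n%:Z] + (y - w0 * B.[n%:Z]) * G.[n%:Z] = e.
  transitivity (x * F.[n%:Z] + y * G.[n%:Z]
                - w0 * (A.[n%:Z] * F.[n%:Z] + B.[n%:Z] * G.[n%:Z])); first by ring.
  rewrite ABDE -wE wnE; ring.
apply: (gcdz_scaled_Bezout _ _ _ _ _ (c * M) _ _ _ _ _ _ _ _ Bez (hN n N_le_n)).
- by rewrite mulf_neq0.
- by have := congr1 (horner^~ n%:Z) PE; rewrite !hornerE -fE mulrA.
- by have := congr1 (horner^~ n%:Z) QE; rewrite !hornerE -gE mulrA.
(* The gcd at [n] equals [e] by mutual divisibility: [e] divides [D], hence [F(n) - F(i)] and
   [G(n) - G(i)]; the converse is [Bez]. *)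
have eFn : (e %| F.[n%:Z])%Z.
  by rewrite -(subrK F.[i%:Z] F.[n%:Z]) rpredD // (dvdz_trans eD).
have eGn : (e %| G.[n%:Z])%Z.
  by rewrite -(subrK G.[i%:Z] G.[n%:Z]) rpredD // (dvdz_trans eD).
have gcd_e : (gcdz F.[n%:Z] G.[n%:Z] %| e)%Z.
  by rewrite -Bez rpredD ?dvdz_mull ?dvdz_gcdl ?dvdz_gcdr.
have e_gcd : (e %| gcdz F.[n%:Z] G.[n%:Z])%Z by rewrite dvdz_gcd eFn.
by congr Posz; apply/eqP; rewrite eqn_dvd; apply/andP.
Qed.

Theorem lemma2p6 (s : nat -> int) (S : int) (t : nat -> int) (T : int)
    (hs : inIQ s S) (ht : inIQ t T) :
  exists (a : nat -> int) (d1 : int) (b : nat -> int) (d2 : int),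
    inIQ a d1 /\ inIQ b d2 /\
    exists N : nat, forall n : nat, (N <= n)%N ->
      gcdz (s n %/ S)%Z (t n %/ T)%Z =
        (a n %/ d1)%Z * (s n %/ S)%Z + (b n %/ d2)%Z * (t n %/ T)%Z.
Proof.
case: hs => [[m1 [p [m1_gt0 sE]]] S_neq0 Ss].
case: ht => [[m2 [q [m2_gt0 tE]]] T_neq0 Tt].
have [C [m [N [a [b [C_neq0 m_gt0 abP]]]]]] : IQ_solvable predT (fun n u v =>
    gcdz (s n %/ S)%Z (t n %/ T)%Z = u * (s n %/ S)%Z + v * (t n %/ T)%Z).
  apply: (@IQ_solvable_glue _ _ m1) => // i _.
  apply: (@IQ_solvable_glue _ _ m2) => // j _.
  (* Cross-scaling by [T] and [S] gives both quotients the same multiplier [S * T]. *)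
  apply: (@gcdz_IQ_solvable_poly _ _ _ (T *: p i) (S *: q j) (S * T)).
    by rewrite mulf_neq0.
  move=> n /andP[/andP[_ /eqP ni] /eqP nj].
  rewrite !hornerZ -{1}ni -nj -sE -tE -{2}(divzK (Ss n)) -{2}(divzK (Tt n)).
  by split; ring.
exists (fun n => (a (n %% m)%N).[n%:Z]), C, (fun n => (b (n %% m)%N).[n%:Z]), C.
split; first by split=> // [|n]; [exists m, a | have [] := abP n isT].
split; first by split=> // [|n]; [exists m, b | have [] := abP n isT].
by exists N => n N_le_n; have [_ _ ->] := abP n isT.
Qed.
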